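(* Let $\mathfrak{g}$ be a finite-dimensional real Lie algebra with an invariant inner product $\langle\,,\rangle_{\mathfrak{g}}$ and let $W$ be a 2-dimensional commutative associative real algebra with unit. Let $\theta:W\to\mathbb{R}$ be a linear form such that the symmetric bilinear form $\langle w_1,w_2\rangle_W:=\theta(w_1w_2)$ on $W$ is non-degenerate and indefinite. Let $V^0_+\subset W$ be a 1-dimensional subspace on which $\langle\,,\rangle_W$ is positive definite, let $V^0_-:=(V^0_+)^\perp$ be its orthogonal complement with respect to $\langle\,,\rangle_W$, and let $e_+\in V^0_+$ and $e_-\in V^0_-$ be non-zero elements. Let $a,b\in\mathbb{R}$ be defined by $$e_+e_-=a\,e_++b\,e_-.$$ Let $\mathfrak{d}:=\mathfrak{g}\otimes W$ with the Lie bracket $[X_1\otimes w_1,X_2\otimes w_2]_{\mathfrak{d}}=[X_1,X_2]_{\mathfrak{g}}\otimes w_1w_2$. For $\lambda\in\mathbb{R}\setminus\{1,-1\}$ let $q_\lambda:W\to\mathbb{R}$ be the linear form $$q_\lambda=\frac{q_+}{1+\lambda}+\frac{q_-}{1-\lambda},$$ where $q_+,q_-\in W^*$ are given by $q_+(e_-)=q_-(e_+)=0$, $q_+(e_+)=2b$, $q_-(e_-)=2a$. Let $\Sigma$ be the cylinder $S^1\times\mathbb{R}$ with the metric $d\sigma^2-d\tau^2$. If $A\in\Omega^1(\Sigma,\mathfrak{d})$ is of the form $A=A_+\otimes e_++A_-\otimes e_-$ with $A_+\in\Omega^{1,0}(\Sigma,\mathfrak{g})$ and $A_-\in\Omega^{0,1}(\Sigma,\mathfrak{g})$,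 and if $A$ is flat, i.e. $dA+[A,A]/2=0$, then for every $\lambda\in\mathbb{R}\setminus\{1,-1\}$ the $\mathfrak{g}$-connection $$A_\lambda=(\operatorname{id}_{\mathfrak{g}}\otimes q_\lambda)(A)=\frac{2b}{1+\lambda}A_++\frac{2a}{1-\lambda}A_-$$ is flat, i.e. $dA_\lambda+[A_\lambda,A_\lambda]/2=0$.
   Context: All objects are real and smooth; tensor products are over $\mathbb{R}$. Since $\langle\,,\rangle_W$ is non-degenerate and positive definite on $V^0_+$, the elements $e_+,e_-$ form a basis of $W$, so $a,b,q_+,q_-$ are well defined. The map $\operatorname{id}_{\mathfrak{g}}\otimes q_\lambda:\mathfrak{g}\otimes W\to\mathfrak{g}$ is given by $x\otimes w\mapsto q_\lambda(w)\,x$ and is applied to the values of $A$. The coordinates on $\Sigma=S^1\times\mathbb{R}$ are $\sigma\in S^1$ and $\tau\in\mathbb{R}$. The decomposition $\Omega^1(\Sigma)=\Omega^{1,0}(\Sigma)\oplus\Omega^{0,1}(\Sigma)$ is the splitting of 1-forms into the two light-cone (null) types: with $\sigma^\pm=\tau\pm\sigma$, $\Omega^{1,0}(\Sigma)$ consists of the forms $u\,d\sigma^+$ and $\Omega^{0,1}(\Sigma)$ of the forms $u\,d\sigma^-$, with $u$ a function on $\Sigma$; $\Omega^{1,0}(\Sigma,\mathfrak{g})$ and $\Omega^{0,1}(\Sigma,\mathfrak{g})$ are the $\mathfrak{g}$-valued versions. For a Lie algebra $\mathfrak{k}$ and $\alpha,\beta\in\Omega^1(\Sigma,\mathfrak{k})$,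 the 2-form $[\alpha,\beta]\in\Omega^2(\Sigma,\mathfrak{k})$ combines the wedge product with the Lie bracket: $[\alpha,\beta](u,v)=[\alpha(u),\beta(v)]-[\alpha(v),\beta(u)]$; thus $([\alpha,\alpha]/2)(u,v)=[\alpha(u),\alpha(v)]$. *)

(* Defs.v *)
From HB Require Import structures.
From mathcomp Require Import all_boot all_order all_algebra.
From mathcomp Require Import all_classical all_reals all_analysis.

Set Implicit Arguments.
Unset Strict Implicit.
Unset Printing Implicit Defensive.

Import Order.TTheory GRing.Theory Num.Theory numFieldNormedType.Exports.
Local Open Scope ring_scope.

(* Finite-dimensional Lie algebras: mathcomp's vectTypes are finite-dimensional
   by definition. *)
HB.mixin Record isLieAlgebra (K : fieldType) L of Vector K L := {
  lie : L -> L -> L;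
  lie_linearl : forall y, linear (lie^~ y);
  lie_linearr : forall x, linear (lie x);
  liexx : forall x, lie x x = 0;
  lie_jacobi : forall x y z,
    lie x (lie y z) + lie y (lie z x) + lie z (lie x y) = 0 }.

#[short(type="lieAlgType")]
HB.structure Definition LieAlgebra (K : fieldType) :=
  {L of isLieAlgebra K L & Vector K L}.

Notation "[ 'lie' x , y ]" := (lie x y)
  (at level 0, x at level 99, format "[ 'lie'  x ,  y ]") : ring_scope.

HB.instance Definition _ (K : fieldType) (L : lieAlgType K) :=
  bilinear_isBilinear.Build K L L L *:%R *:%R (@lie K L)
    (@lie_linearl K L, @lie_linearr K L).

(* Finite-dimensional commutative associative unital algebras. *)
#[short(type="comVectAlgType")]
HB.structure Definition ComVectAlgebra (K : fieldType) :=
  {W of GRing.ComAlgebra K W & Vector K W}.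

Section Tensor.
Variable K : fieldType.

Definition dual (V : vectType K) := 'Hom(V, K^o).

(* The model Hom(V^*, U) of U (x) V, with x (x) w := (f |-> f(w) x);
   tensor_universal below is its universal property. *)
Definition tensor (U V : vectType K) := 'Hom(dual V, U).
HB.instance Definition _ U V := Vector.on (tensor U V).

Definition tens (U V : vectType K) (x : U) (w : V) : tensor U V :=
  linfun (fun f : dual V => f w *: x).

Definition dual_vbasis (V : vectType K) (i : 'I_(\dim {:V})) : dual V :=
  linfun (coord (vbasis {:V}) i : V -> K^o).

(* id_U (x) q : U (x) V -> U, the linear map with x (x) w |-> q(w) x
   (lemma id_tens_tens); in this model it is evaluation at q. *)
Definition id_tens (U V : vectType K) (q : dual V) (T : tensor U V) : U :=
  (T : 'Hom(dual V, U)) q.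

Section TensorTheory.
Variables U V : vectType K.
Implicit Types (x : U) (w : V) (f q : dual V) (T S : tensor U V).

Lemma id_tens_linear q : linear (@id_tens U V q).
Proof. by move=> k T S; rewrite /id_tens add_lfunE scale_lfunE. Qed.

HB.instance Definition _ q :=
  GRing.isLinear.Build K (tensor U V) U *:%R (@id_tens U V q)
    (id_tens_linear q).

Lemma id_tens_linearq T : linear (fun q => id_tens q T).
Proof. by move=> k f q; exact: (linearP (T : 'Hom(dual V, U))). Qed.

Lemma id_tens_tens q x w : id_tens q (tens x w) = q w *: x.
Proof.
have lin : linear (fun f : dual V => f w *: x).
  by move=> k f1 f2; rewrite add_lfunE scale_lfunE scalerDl scalerA.
pose m := GRing.isLinear.Build _ _ _ _ (fun f : dual V => f w *: x) lin.
pose F : {linear dual V -> U} := HB.pack (fun f : dual V => f w *: x) m.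
exact: (lfunE F).
Qed.

Lemma tensorP T S : (forall q, id_tens q T = id_tens q S) -> T = S.
Proof. by move=> TS; apply/lfunP => q; apply: TS. Qed.

Lemma tens_linearl w : linear (fun x => tens x w).
Proof.
move=> k x y; apply: tensorP => f.
by rewrite linearP /= !id_tens_tens scalerDr !scalerA mulrC.
Qed.

Lemma tens_linearr x : linear (@tens U V x).
Proof.
move=> k v w; apply: tensorP => f.
by rewrite linearP /= !id_tens_tens linearP scalerDl scalerA.
Qed.

HB.instance Definition _ :=
  bilinear_isBilinear.Build K U V (tensor U V) *:%R *:%R (@tens U V)
    (tens_linearl, tens_linearr).

Lemma dual_vbasisE f : f = \sum_(i < \dim {:V}) f (vbasis {:V})`_i *: dual_vbasis i.
Proof.
apply/lfunP => w; rewrite sum_lfunE {1}(coord_vbasis (memvf w)) linear_sum.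
by apply: eq_bigr => i _; rewrite linearZ scale_lfunE lfunE /= -[RHS]mulrC.
Qed.

Lemma tensor_sum T :
  T = \sum_(i < \dim {:V}) tens (id_tens (dual_vbasis i) T) (vbasis {:V})`_i.
Proof.
apply: tensorP => f; rewrite linear_sum /= {1}(dual_vbasisE f).
rewrite /id_tens linear_sum; apply: eq_bigr => i _.
by rewrite linearZ [RHS]id_tens_tens.
Qed.

Lemma tensor_ind (P : tensor U V -> Prop) :
  P 0 -> (forall S T, P S -> P T -> P (S + T)) ->
  (forall x w, P (tens x w)) -> forall T, P T.
Proof. by move=> P0 PD Pt T; rewrite (tensor_sum T); apply: big_ind. Qed.

Lemma tensor_universal (Z : vectType K) (B : {bilinear U -> V -> Z}) :
  exists! F : 'Hom(tensor U V, Z), forall x w, F (tens x w) = B x w.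
Proof.
pose h T : Z := \sum_(i < \dim {:V}) B (id_tens (dual_vbasis i) T) (vbasis {:V})`_i.
have hlin : linear h.
  move=> k T S; rewrite /h scaler_sumr -big_split; apply: eq_bigr => i _ /=.
  by rewrite linearP /= linearPl.
pose m := GRing.isLinear.Build _ _ _ _ h hlin.
pose F : {linear tensor U V -> Z} := HB.pack h m.
exists (linfun F); split=> [x w|G GB].
  rewrite lfunE /= /h [in RHS](coord_vbasis (memvf w)) linear_sumr.
  apply: eq_bigr => i _.
  by rewrite id_tens_tens lfunE /= linearZl_LR linearZr_LR.
apply/lfunP => T; rewrite lfunE /= [in RHS](tensor_sum T) linear_sum /=.
by apply: eq_bigr => i _; rewrite GB.
Qed.

End TensorTheory.

Section TensorLie.
Variables (L : lieAlgType K) (W : comVectAlgType K).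
Local Notation d := (tensor L W).

(* The bilinear extension of
   [x1 (x) w1, x2 (x) w2] = [x1, x2] (x) w1 w2 (lemma tensor_lie_tens). *)
Definition tensor_lie (S T : d) : d :=
  \sum_(i < \dim {:W}) \sum_(j < \dim {:W})
    tens [lie id_tens (dual_vbasis i) S, id_tens (dual_vbasis j) T]
         ((vbasis {:W})`_i * (vbasis {:W})`_j).

Lemma tensor_lie_linearl T : linear (tensor_lie^~ T).
Proof.
move=> k S1 S2; rewrite /tensor_lie scaler_sumr -big_split; apply: eq_bigr.
move=> i _ /=; rewrite scaler_sumr -big_split; apply: eq_bigr => j _ /=.
by rewrite linearP /= linearPl linearPl.
Qed.

Lemma tensor_lie_linearr S : linear (tensor_lie S).
Proof.
move=> k S1 S2; rewrite /tensor_lie scaler_sumr -big_split; apply: eq_bigr.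
move=> i _ /=; rewrite scaler_sumr -big_split; apply: eq_bigr => j _ /=.
by rewrite linearP /= linearPr linearPl.
Qed.

HB.instance Definition _ :=
  bilinear_isBilinear.Build K d d d *:%R *:%R tensor_lie
    (tensor_lie_linearl, tensor_lie_linearr).

Lemma tensor_lie_tens x1 w1 x2 w2 :
  tensor_lie (tens x1 w1) (tens x2 w2) = tens [lie x1, x2] (w1 * w2).
Proof.
rewrite /tensor_lie [in RHS](coord_vbasis (memvf w1)) mulr_suml linear_sumr.
apply: eq_bigr => i _.
rewrite [in RHS](coord_vbasis (memvf w2)) mulr_sumr linear_sumr.
apply: eq_bigr => j _; rewrite !id_tens_tens !lfunE /=.
rewrite -scalerAl -scalerAr linearZl_LR linearZr_LR /=.
by rewrite !linearZl_LR !linearZr_LR.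
Qed.

Lemma lieC (x y : L) : [lie x, y] = - [lie y, x].
Proof.
apply/eqP; rewrite -addr_eq0; apply/eqP; have := liexx (x + y).
by rewrite linearDl !linearDr /= !liexx add0r addr0.
Qed.

Lemma tensor_lieC S T : tensor_lie S T = - tensor_lie T S.
Proof.
elim/tensor_ind: S => [|S1 S2 h1 h2|x v]; first by rewrite linear0l linear0r oppr0.
  by rewrite linearDl linearDr /= h1 h2 opprD.
elim/tensor_ind: T => [|T1 T2 h1 h2|y w]; first by rewrite linear0l linear0r oppr0.
  by rewrite linearDl linearDr /= h1 h2 opprD.
by rewrite !tensor_lie_tens lieC linearNl mulrC.
Qed.

Lemma tensor_liexx S : tensor_lie S S = 0.
Proof.
elim/tensor_ind: S => [|S T hS hT|x w]; first by rewrite linear0l.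
  rewrite linearDl !linearDr /= hS hT add0r addr0 /=.
  by rewrite (tensor_lieC T) subrr.
by rewrite tensor_lie_tens liexx linear0l.
Qed.

Lemma tensor_lie_jacobi S T P :
  tensor_lie S (tensor_lie T P) + tensor_lie T (tensor_lie P S) +
  tensor_lie P (tensor_lie S T) = 0.
Proof.
have shuffle (a b c a' b' c' : d) : a + b + c = 0 -> a' + b' + c' = 0 ->
    (a + a') + (b + b') + (c + c') = 0.
  by move=> h h'; rewrite (addrACA a) (addrACA (a + b)) h h' addr0.
elim/tensor_ind: S => [|S1 S2 h1 h2|x u].
- by rewrite !(linear0l, linear0r) !addr0.
- by rewrite !(linearDl, linearDr) /=; apply: shuffle.
elim/tensor_ind: T => [|S1 S2 h1 h2|y v].
- by rewrite !(linear0l, linear0r) !addr0.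
- by rewrite !(linearDl, linearDr) /=; apply: shuffle.
elim/tensor_ind: P => [|S1 S2 h1 h2|z w].
- by rewrite !(linear0l, linear0r) !addr0.
- by rewrite !(linearDl, linearDr) /=; apply: shuffle.
rewrite !tensor_lie_tens.
rewrite [v * (w * u)]mulrA [v * w * u]mulrC [w * (u * v)]mulrC -[u * v * w]mulrA.
by rewrite -!linearDl /= lie_jacobi linear0l.
Qed.

HB.instance Definition _ :=
  isLieAlgebra.Build K d tensor_lie_linearl tensor_lie_linearr
    tensor_liexx tensor_lie_jacobi.

Lemma lie_tens (x1 x2 : L) (w1 w2 : W) :
  [lie tens x1 w1, tens x2 w2] = tens [lie x1, x2] (w1 * w2).
Proof. exact: tensor_lie_tens. Qed.

End TensorLie.

Section AlgForm.
Variables (W : comVectAlgType K) (theta : dual W).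

Definition alg_pairing (w1 w2 : W) : K := theta (w1 * w2).

Lemma alg_pairing_bilinear : bilinear_for *%R *%R alg_pairing.
Proof.
split=> w k u v; rewrite /alg_pairing; first by rewrite mulrDl -scalerAl linearP.
by rewrite mulrDr -scalerAr linearP.
Qed.

HB.instance Definition _ :=
  bilinear_isBilinear.Build K W W K *%R *%R alg_pairing alg_pairing_bilinear.

Lemma alg_pairing_sym w1 w2 :
  alg_pairing w1 w2 = (-1) ^+ false * idfun (alg_pairing w2 w1).
Proof. by rewrite mul1r /alg_pairing mulrC. Qed.

HB.instance Definition _ :=
  isHermitianSesquilinear.Build K W false idfun alg_pairing alg_pairing_sym.

(* <w1, w2>_W = theta(w1 w2), as a symmetric bilinear form *)
Definition alg_form : {symmetric W} := alg_pairing.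

End AlgForm.

End Tensor.

Definition invariant_form (K : fieldType) (L : lieAlgType K)
    (B : {symmetric L}) :=
  forall x y z, B [lie x, y] z = B x [lie y, z].

Definition indefinite (R : realFieldType) (V : lmodType R)
    (B : {symmetric V}) :=
  (exists v, 0 < B v v) /\ (exists v, B v v < 0).

(* An "inner product" on a Lie algebra is a nondegenerate symmetric form, not
   necessarily definite; positive definite forms are a special case. *)
Lemma posdef_nondegenerate (R : realFieldType) (V : vectType R)
    (B : {symmetric V}) :
  (forall v, v != 0 -> 0 < B v v) -> nondegenerate B.
Proof.
move=> Bpos; rewrite /nondegenerate -subv0; apply/subvP => v /mem_orthovP Bv.
rewrite memv0; apply/eqP/eqP; apply: contraT => /Bpos.
by rewrite Bv ?memvf // ltxx.
Qed.

(* The cylinder S^1 x R with S^1 = R / 2 pi Z: points are represented by pairs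
   (sigma, tau) on the universal cover, and functions and forms are required
   to be 2 pi-periodic in sigma. The tangent bundle is trivialised by
   d/dsigma, d/dtau, so tangent vectors v are pairs (dsigma(v), dtau(v)), and
   V-valued 1- and 2-forms are functions of a point and one or two tangent
   vectors. *)
Section Cylinder.
Variable R : realType.
Implicit Types V : vectType R.

Local Notation point := (R * R)%type.
Local Notation tangent := (R * R)%type.

Definition form1 V := point -> tangent -> V.
Definition form2 V := point -> tangent -> tangent -> V.

Definition periodic (T : Type) (f : point -> T) :=
  forall sigma tau, f (sigma + 2 * pi, tau) = f (sigma, tau).

(* A map on R^2 is C^(k+1) iff its directional derivatives exist and are C^k. *)
Fixpoint Ck (k : nat) (f : point -> R) : Prop :=
  if k is k'.+1 then
    forall u : tangent, (forall p, derivable f p u) /\ Ck k' ('D_u f)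
  else continuous f.

(* A vectType has no built-in topology, so smoothness and derivatives of
   V-valued maps are taken in coordinates; neither depends on the basis (for
   vderive see vderive_dual). *)
Definition vcoord V (i : 'I_(\dim {:V})) (x : V) : R :=
  coord (vbasis {:V}) i x.

Definition smooth V (f : point -> V) := forall k i, Ck k (vcoord i \o f).

Definition vderive V (u : tangent) (f : point -> V) (p : point) : V :=
  \sum_(i < \dim {:V}) 'D_u (vcoord i \o f) p *: (vbasis {:V})`_i.

Lemma vderive_dual V (l : dual V) (f : point -> V) u p :
  smooth f -> l (vderive u f p) = 'D_u (fun x => l (f x) : R) p.
Proof.
move=> fs; have df i : derivable (vcoord i \o f) p u.
  by have [+ _] := fs 1%N i u; apply.
have -> : (fun x => l (f x) : R) =
    \sum_(i < \dim {:V}) l (vbasis {:V})`_i \*: (vcoord i \o f).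
  apply/funext => x; rewrite fct_sumE {1}(coord_vbasis (memvf (f x))).
  by rewrite linear_sum; apply: eq_bigr => i _; rewrite linearZ; exact: mulrC.
rewrite derive_sum => [|i]; last exact: derivableZ.
rewrite /vderive linear_sum; apply: eq_bigr => i _.
by rewrite deriveZ // linearZ; exact: mulrC.
Qed.

Definition Omega1 V (alpha : form1 V) :=
  (forall p, linear (alpha p)) /\
  (forall v, smooth (alpha^~ v) /\ periodic (alpha^~ v)).

(* the metric dsigma^2 - dtau^2 *)
Definition cyl_metric (v w : tangent) : R := v.1 * w.1 - v.2 * w.2.

(* the null 1-forms dsigma^+ and dsigma^-, where sigma^(+-) = tau +- sigma *)
Definition dsigma_p (v : tangent) : R := v.2 + v.1.
Definition dsigma_m (v : tangent) : R := v.2 - v.1.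

Lemma cyl_metric_null v : cyl_metric v v = - (dsigma_p v * dsigma_m v).
Proof.
by rewrite /cyl_metric /dsigma_p /dsigma_m [in RHS]mulrC -subr_sqr opprB !expr2.
Qed.

Definition Omega10 V (alpha : form1 V) :=
  exists u : point -> V,
    [/\ smooth u, periodic u & forall p v, alpha p v = dsigma_p v *: u p].

Definition Omega01 V (alpha : form1 V) :=
  exists u : point -> V,
    [/\ smooth u, periodic u & forall p v, alpha p v = dsigma_m v *: u p].

(* dalpha(u, v) = D_u(alpha(v)) - D_v(alpha(u)) for constant fields u, v *)
Definition dform V (alpha : form1 V) : form2 V :=
  fun p u v => vderive u (alpha^~ v) p - vderive v (alpha^~ u) p.

Definition lie_form (L : lieAlgType R) (alpha beta : form1 L) : form2 L :=
  fun p u v => [lie alpha p u, beta p v] - [lie alpha p v, beta p u].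

Definition flat (L : lieAlgType R) (alpha : form1 L) :=
  forall p u v, dform alpha p u v + 2^-1 *: lie_form alpha alpha p u v = 0.

End Cylinder.

(* Main.v *)
(* Let C be the 2-form [A_+, A_-].  Each of A_+ and A_- is a g-valued function
   times a single scalar 1-form, so the e_+^2 and e_-^2 terms of [A, A]/2 vanish and
   [A, A]/2 = C (x) e_+ e_- = C (x) (a e_+ + b e_-).  Applying id (x) q, for any
   linear form q on W, to the flatness of A gives d(q A) = - q(e_+ e_-) C, whereas
   [q A, q A]/2 = q(e_+) q(e_-) C.  Hence q A is flat as soon as
   q(e_+ e_-) = q(e_+) q(e_-), and for q_lambda both sides equal
   4ab / (1 - lambda^2). *)
Require Import Defs.
From mathcomp Require Import all_boot all_order all_algebra.
From mathcomp Require Import all_classical all_reals all_analysis.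
From mathcomp Require Import ring.
Import Order.TTheory GRing.Theory Num.Theory numFieldNormedType.Exports.
Local Open Scope ring_scope.

Section Smoothness.
Context {R : realType}.

(** Induction on [k], for all [f] and [h] at once: ['D_u] turns the combination into the same
    combination of ['D_u f] and ['D_u h]. *)
Lemma Ck_linear_comb k (c : R) (f h : R * R -> R) :
  Ck k f -> Ck k h -> Ck k (c \*: f + h).
Proof.
elim: k f h => [|k IHk] f h /= fk hk.
  by move=> x; apply: cvgD; [apply: cvgZl_tmp; exact: fk | exact: hk].
move=> u; have [df Df] := fk u; have [dh Dh] := hk u.
split=> [p|]; first by apply: derivableD => //; exact: derivableZ.
suff -> : 'D_u (c \*: f + h) = c \*: 'D_u f + 'D_u h by exact: IHk.
by apply/funext => p; rewrite deriveD ?deriveZ//; exact: derivableZ.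
Qed.

Lemma Ck0 k : Ck k (0 : R * R -> R).
Proof.
elim: k => [|k IHk] /=; first by move=> x; exact: cst_continuous.
move=> u; split=> [p|]; first exact: derivable_cst.
suff -> : 'D_u (0 : R * R -> R) = 0 by [].
by apply/funext => p; exact: derive_cst.
Qed.

(** [smooth] only controls coordinates in one fixed basis, but [l] after [f] is a combination of
    these coordinates with constant coefficients, the values of [l] on that basis. *)
Lemma Ck_dual {V : vectType R} (l : dual V) (f : R * R -> V) k :
  smooth f -> Ck k (fun x => l (f x) : R).
Proof.
move=> fs; have -> : (fun x => l (f x) : R) =
    \sum_(i < \dim {:V}) l (vbasis {:V})`_i \*: (vcoord i \o f).
  apply/funext => x; rewrite fct_sumE {1}(coord_vbasis (memvf (f x))).
  by rewrite linear_sum; apply: eq_bigr => i _; rewrite linearZ; exact: mulrC.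
elim/big_rec: _ => [|i h _ hk]; first exact: Ck0.
by apply: Ck_linear_comb => //; exact: fs.
Qed.

(** Reduces vector-valued maps to linear forms, so that [Ck_dual] and [vderive_dual] apply to each
    coordinate of [F]. *)
Lemma vcoord_linear {U V : vectType R} (F : {linear V -> U}) i :
  exists l : dual V, forall x, l x = vcoord i (F x).
Proof.
exists (linfun (coord (vbasis {:U}) i \o F : V -> R^o)) => x.
by rewrite lfunE.
Qed.

Lemma smooth_linear {U V : vectType R} (F : {linear V -> U}) (f : R * R -> V) :
  smooth f -> smooth (F \o f).
Proof.
move=> fs k i; have [l lE] := vcoord_linear F i.
rewrite (_ : _ \o _ = fun x => l (f x) : R); first exact: Ck_dual.
by apply/funext => x; rewrite /= lE.
Qed.

Lemma vderive_linear {U V : vectType R} (F : {linear V -> U}) u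
    (f : R * R -> V) p :
  smooth f -> vderive u (F \o f) p = F (vderive u f p).
Proof.
move=> fs; rewrite [RHS](coord_vbasis (memvf _)); apply: eq_bigr => i _.
have [l lE] := vcoord_linear F i; congr (_ *: _).
rewrite -/(vcoord i _) -lE vderive_dual//; congr ('D_u _ p).
by apply/funext => x; rewrite /= lE.
Qed.

Lemma Omega1_linear {U V : vectType R} (F : {linear V -> U}) (alpha : form1 V) :
  Omega1 alpha -> Omega1 (fun p v => F (alpha p v)).
Proof.
move=> [al as_]; split=> [p k u v|v]; first by rewrite al linearP.
have [sv pv] := as_ v; split; first exact: smooth_linear F _ sv.
by move=> s t; congr (F _); exact: pv.
Qed.

(** A constant linear map commutes with directional derivatives, hence with the exterior derivative;
    this is used for the map [id_tens q]. *)
Lemma dform_linear {U V : vectType R} (F : {linear V -> U}) (alpha : form1 V)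
    p u v :
  Omega1 alpha ->
  dform (fun p v => F (alpha p v)) p u v = F (dform alpha p u v).
Proof.
move=> [_ as_]; rewrite /dform linearB /=; congr (_ - _).
  by apply: (vderive_linear F); have [] := as_ v.
by apply: (vderive_linear F); have [] := as_ u.
Qed.

End Smoothness.

Section Flatness.
Context {R : realType}.

(** By antisymmetry of the bracket the two terms of [lie_form alpha alpha] coincide, which absorbs
    the factor 1/2. *)
Lemma half_lie_form {L : lieAlgType R} (alpha : form1 L) p u v :
  2^-1 *: lie_form alpha alpha p u v = [lie alpha p u, alpha p v].
Proof.
rewrite /lie_form (lieC (alpha p v)) opprK scalerDr -scalerDl.
by rewrite (_ : 2^-1 + 2^-1 = 1 :> R) ?scale1r//; field.
Qed.

(** At a given point, all values of [alpha] are multiples of a single vector. *)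
Lemma lie_Omega10 {L : lieAlgType R} (alpha : form1 L) p u v :
  Omega10 alpha -> [lie alpha p u, alpha p v] = 0.
Proof.
by move=> [w [_ _ aE]]; rewrite !aE linearZl_LR linearZr_LR /= liexx !scaler0.
Qed.

Lemma lie_Omega01 {L : lieAlgType R} (alpha : form1 L) p u v :
  Omega01 alpha -> [lie alpha p u, alpha p v] = 0.
Proof.
by move=> [w [_ _ aE]]; rewrite !aE linearZl_LR linearZr_LR /= liexx !scaler0.
Qed.

(** The pure terms vanish by nullity; the two mixed terms both carry [s * t] and assemble into
    [lie_form Ap Am]. *)
Lemma lie_null_comb {L : lieAlgType R} (Ap Am : form1 L) (s t : R) p u v :
  Omega10 Ap -> Omega01 Am ->
  [lie s *: Ap p u + t *: Am p u, s *: Ap p v + t *: Am p v] =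
  (s * t) *: lie_form Ap Am p u v.
Proof.
move=> hp hm; rewrite linearDl !linearDr /= !(linearZl_LR, linearZr_LR) /=.
rewrite (lie_Omega10 _ _ _ _ hp) (lie_Omega01 _ _ _ _ hm) !scaler0.
rewrite add0r addr0 /lie_form (lieC (Am p u)) !scalerA scalerBr scalerN.
by rewrite (mulrC t).
Qed.

(** Only mixed terms survive again, and commutativity of [W] gives both the same second factor
    [ep * em]. *)
Lemma lie_null_tens {L : lieAlgType R} {W : comVectAlgType R}
    (Ap Am : form1 L) (ep em : W) p u v :
  Omega10 Ap -> Omega01 Am ->
  [lie tens (Ap p u) ep + tens (Am p u) em,
       tens (Ap p v) ep + tens (Am p v) em] =
  tens (lie_form Ap Am p u v) (ep * em).
Proof.
move=> hp hm; rewrite linearDl !linearDr /= !lie_tens.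
rewrite (lie_Omega10 _ _ _ _ hp) (lie_Omega01 _ _ _ _ hm) !linear0l.
by rewrite add0r addr0 (lieC (Am p u)) (mulrC em) -linearDl.
Qed.

Lemma flat_id_tens {L : lieAlgType R} {W : comVectAlgType R}
    (A : form1 (tensor L W)) (Ap Am : form1 L) (ep em : W) (q : dual W) :
  Omega1 A -> Omega10 Ap -> Omega01 Am ->
  (forall p v, A p v = tens (Ap p v) ep + tens (Am p v) em) ->
  q (ep * em) = q ep * q em ->
  flat A -> flat (fun p v => id_tens q (A p v)).
Proof.
move=> A1 hp hm AE qM Aflat p u v.
have := congr1 (id_tens q) (Aflat p u v).
rewrite !half_lie_form !AE lie_null_tens// linearD linear0 /= id_tens_tens qM.
(* The zero on the right is replaced by the image of the flatness equation of [A]; the derivative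
   terms agree, leaving only the bracket terms to compare. *)
rewrite (dform_linear (@id_tens R L W q)) // => <-; congr (_ + _).
have qA x y : id_tens q (tens x ep + tens y em) = q ep *: x + q em *: y.
  by rewrite linearD /= !id_tens_tens.
by rewrite !qA lie_null_comb.
Qed.

End Flatness.

Theorem mainTheorem3 (R : realType)
  (g : lieAlgType R) (ip : {symmetric g})
  (ip_nondeg : nondegenerate ip) (ip_inv : invariant_form ip)
  (W : comVectAlgType R) (dimW : \dim {:W} = 2%N) (theta : dual W)
  (theta_nondeg : nondegenerate (alg_form theta))
  (theta_indef : indefinite (alg_form theta))
  (Vp Vm : {vspace W}) (dimVp : \dim Vp = 1%N)
  (Vp_pos : forall w, w \in Vp -> w != 0 -> 0 < alg_form theta w w)
  (Vm_orth : Vm = orthov (alg_form theta) Vp)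
  (ep em : W) (ep_in : ep \in Vp) (ep_neq0 : ep != 0)
  (em_in : em \in Vm) (em_neq0 : em != 0)
  (a b : R) (ab : ep * em = a *: ep + b *: em)
  (qp qm : dual W) (qp_em : qp em = 0) (qm_ep : qm ep = 0)
  (qp_ep : qp ep = 2 * b) (qm_em : qm em = 2 * a)
  (A : form1 (tensor g W)) (Ap Am : form1 g)
  (A_form : Omega1 A) (Ap_form : Omega10 Ap) (Am_form : Omega01 Am)
  (A_def : forall p v, A p v = tens (Ap p v) ep + tens (Am p v) em)
  (A_flat : flat A)
  (lambda : R) (lambda_neq1 : lambda != 1) (lambda_neqN1 : lambda != -1) :
  let q_lambda : dual W := (1 + lambda)^-1 *: qp + (1 - lambda)^-1 *: qm in
  let A_lambda : form1 g := fun p v => id_tens q_lambda (A p v) in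
  [/\ Omega1 A_lambda,
      forall p v, A_lambda p v =
        (2 * b / (1 + lambda)) *: Ap p v + (2 * a / (1 - lambda)) *: Am p v
    & flat A_lambda].
Proof.
move=> ql Al.
have qp_l : ql ep = 2 * b / (1 + lambda).
  (* Scaling in the codomain of a linear form is multiplication by definition, so [mulrC] closes the
     goal. *)
  by rewrite /ql add_lfunE !scale_lfunE qp_ep qm_ep scaler0 addr0; exact: mulrC.
have qm_l : ql em = 2 * a / (1 - lambda).
  by rewrite /ql add_lfunE !scale_lfunE qp_em qm_em scaler0 add0r; exact: mulrC.
split.
- exact: (Omega1_linear (@id_tens R g W ql)).
- by move=> p v; rewrite /Al A_def linearD /= !id_tens_tens qp_l qm_l.
- apply: (flat_id_tens _ _ _ _ _ _ A_form Ap_form Am_form A_def _ A_flat).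
  (* The identity is 2ab/(1 + lambda) + 2ab/(1 - lambda) = 4ab/((1 + lambda)(1 - lambda)); [field]
     leaves the non-vanishing of the denominators. *)
  rewrite ab linearD !linearZ /= qp_l qm_l /GRing.scale /=; field.
  by rewrite subr_eq0 eq_sym lambda_neq1 addrC -[1]opprK subr_eq0 lambda_neqN1.
Qed.
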